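(* Let $T$ be a complete theory with monster model $\mathbb M$, and let $\mathrm{cl}$ be an existential matroid on $\mathbb M$. Assume that $T$ expands the theory of rings without zero divisors (in the language of rings $(0,1,+,\cdot)$). Then $\mathrm{cl}$ is the only existential matroid on $\mathbb M$. Moreover, if $S$ is a definable subfield of $\mathbb M$ with $\dim^{\mathrm{cl}}(S)=1$, then $S=\mathbb M$.
   Context: Conventions: $T$ is a complete first-order theory in a language $\mathcal L$ with only infinite models; $\kappa>|T|$ is a large cardinal; $\mathbb M$ is a monster model, i.e. a $\kappa$-saturated, strongly $\kappa$-homogeneous model of $T$. ''Small'' means of cardinality $<\kappa$; ''definable'' means definable with parameters. A (finitary) matroid on $\mathbb M$ is an operator $\mathrm{cl}:\mathcal P(\mathbb M)\to\mathcal P(\mathbb M)$ with: $X\subseteq \mathrm{cl}(X)$; $X\subseteq Y\Rightarrow \mathrm{cl}(X)\subseteq \mathrm{cl}(Y)$; $\mathrm{cl}(\mathrm{cl}(X))=\mathrm{cl}(X)$; $\mathrm{cl}(X)=\bigcup\{\mathrm{cl}(A): A\subseteq X \text{ finite}\}$; and the exchange principle: $a\in \mathrm{cl}(X\cup\{c\})\setminus \mathrm{cl}(X)$ implies $c\in\mathrm{cl}(X\cup\{a\})$. An $\mathcal L$-formula $\phi(x,\bar y)$ without parameters, $x$ a single variable, is $x$-narrow if for all $a,\bar b$, $\mathbb M\models\phi(a,\bar b)$ implies $a\in\mathrm{cl}(\bar b)$. The matroid is definable if for every $A$, $\mathrm{cl}(A)$ is the union of the sets $\phi(\mathbb M,\bar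 a)$ with $\phi(x,\bar y)$ $x$-narrow and $\bar a$ a finite tuple from $A$. It satisfies Existence if for every element $a$ and all small $B,C$ with $a\notin\mathrm{cl}(B)$ there is $a'$ with the same type as $a$ over $B$ and $a'\notin\mathrm{cl}(B\cup C)$. The trivial matroid is $\mathrm{cl}^0(X)=\mathbb M$ for all $X$. An existential matroid is a definable matroid that satisfies Existence and is not the trivial matroid. $\mathrm{rk}^{\mathrm{cl}}(\bar b/A)$ is the cardinality of a maximal subtuple of $\bar b$ that is $\mathrm{cl}$-independent over $A$. For $V\subseteq\mathbb M^n$ definable over a small set $A$, $\dim^{\mathrm{cl}}(V)=\max\{\mathrm{rk}^{\mathrm{cl}}(\bar b/A):\bar b\in V\}$, and $\dim^{\mathrm{cl}}(\emptyset)=-\infty$ (this does not depend on $A$). *)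

(* Defs.v *)
From mathcomp Require Import all_boot.
From mathcomp Require Import boolp classical_sets functions cardinality.

Set Implicit Arguments.
Unset Strict Implicit.
Unset Printing Implicit Defensive.

Local Open Scope classical_set_scope.
Local Open Scope card_scope.

(** * First-order logic *)

Record language : Type := Language {
  funsym : Type;
  farity : funsym -> nat;
  relsym : Type;
  rarity : relsym -> nat
}.

Inductive term (L : language) (n : nat) : Type :=
| Var of 'I_n
| App (f : funsym L) of ('I_(farity f) -> term L n).

(* [formula L n] : formulas with free variables among 0, ..., n-1.  The
   variable bound by [Fall] and [Fex] is the last one, of index n. *)
Inductive formula (L : language) : nat -> Type :=
| Feq n : term L n -> term L n -> formula L n
| Frel n (r : relsym L) : ('I_(rarity r) -> term L n) -> formula L n
| Fbot n : formula L n
| Fand n : formula L n -> formula L n -> formula L n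
| For n : formula L n -> formula L n -> formula L n
| Fimp n : formula L n -> formula L n -> formula L n
| Fall n : formula L n.+1 -> formula L n
| Fex n : formula L n.+1 -> formula L n.

Definition Fnot L n (phi : formula L n) : formula L n := Fimp phi (Fbot L n).

Definition sentence (L : language) := formula L 0.

Record structure (L : language) : Type := Structure {
  carrier :> Type;
  carrier_inh : inhabited carrier;
  finterp : forall f : funsym L, ('I_(farity f) -> carrier) -> carrier;
  rinterp : forall r : relsym L, ('I_(rarity r) -> carrier) -> Prop
}.

Definition tnil (X : Type) : 'I_0 -> X :=
  fun i => False_rect X (notF (ltn_ord i)).

Definition tpair (X : Type) (x y : X) : 'I_2 -> X :=
  fun i => if i == ord0 then x else y.

Definition tsnoc (X : Type) n (v : 'I_n -> X) (x : X) : 'I_n.+1 -> X :=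
  fun i => if unlift ord_max i is Some j then v j else x.

Definition tcat (X : Type) n m (v : 'I_n -> X) (w : 'I_m -> X) :
    'I_(n + m) -> X :=
  fun i => match fintype.split i with inl j => v j | inr k => w k end.

Fixpoint eval L (M : structure L) n (v : 'I_n -> M) (t : term L n) : M :=
  match t with
  | Var i => v i
  | App f ts => finterp (fun i => eval v (ts i))
  end.

Fixpoint sat L (M : structure L) n (phi : formula L n) : ('I_n -> M) -> Prop :=
  match phi with
  | Feq _ s t => fun v => eval v s = eval v t
  | Frel _ r ts => fun v => rinterp (fun i => eval v (ts i))
  | Fbot _ => fun _ => False
  | Fand _ p q => fun v => sat p v /\ sat q v
  | For _ p q => fun v => sat p v \/ sat q v
  | Fimp _ p q => fun v => sat p v -> sat q v
  | Fall _ p => fun v => forall x : M, sat p (tsnoc v x)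
  | Fex _ p => fun v => exists x : M, sat p (tsnoc v x)
  end.

Definition theory (L : language) := set (sentence L).

Definition models L (M : structure L) (T : theory L) : Prop :=
  forall phi, T phi -> sat phi (@tnil M).

Definition entails L (T : theory L) (phi : sentence L) : Prop :=
  forall M : structure L, models M T -> sat phi (@tnil M).

Definition complete_theory L (T : theory L) : Prop :=
  (exists M : structure L, models M T) /\
  (forall phi, entails T phi \/ entails T (Fnot phi)).

Definition only_infinite_models L (T : theory L) : Prop :=
  forall M : structure L, models M T -> infinite_set [set: M].

(** * Expansions of a language *)

Record expansion (L0 L : language) : Type := Expansion {
  fincl : funsym L0 -> funsym L;
  fincl_inj : injective fincl;
  fincl_arity : forall f, farity (fincl f) = farity f;
  rincl : relsym L0 -> relsym L;
  rincl_inj : injective rincl;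
  rincl_arity : forall r, rarity (rincl r) = rarity r
}.

Definition reduct L0 L (e : expansion L0 L) (M : structure L) :
    structure L0 :=
  @Structure L0 M (carrier_inh M)
    (fun f args =>
       @finterp L M (fincl e f) (fun i => args (cast_ord (fincl_arity e f) i)))
    (fun r args =>
       @rinterp L M (rincl e r) (fun i => args (cast_ord (rincl_arity e r) i))).

Definition expands L0 L (e : expansion L0 L) (T : theory L) (T0 : theory L0) :
    Prop :=
  forall M : structure L, models M T -> models (reduct e M) T0.

(** * The theory of rings without zero divisors *)

Inductive ring_fun : Type := Rzero | Rone | Radd | Rmul.

Definition ring_language : language :=
  @Language ring_fun
    (fun f => match f with Rzero | Rone => 0 | Radd | Rmul => 2 end)
    Empty_set (fun r => match r with end).

Section RingTheory.

Local Notation rterm := (term ring_language).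

Definition tzero n : rterm n := @App ring_language n Rzero (@tnil _).
Definition tone n : rterm n := @App ring_language n Rone (@tnil _).
Definition tadd n (s t : rterm n) : rterm n :=
  @App ring_language n Radd (tpair s t).
Definition tmul n (s t : rterm n) : rterm n :=
  @App ring_language n Rmul (tpair s t).
Definition tvar n k (lt_kn : k < n) : rterm n :=
  Var ring_language (Ordinal lt_kn).
Definition all3 (phi : formula ring_language 3) : sentence ring_language :=
  Fall (Fall (Fall phi)).

Local Notation x := (@tvar 3 0 isT).
Local Notation y := (@tvar 3 1 isT).
Local Notation z := (@tvar 3 2 isT).

(* Rings are associative and unital, not necessarily commutative. *)
Inductive ring_no_zero_div : theory ring_language :=
| ring_addA : ring_no_zero_div
    (all3 (Feq (tadd x (tadd y z)) (tadd (tadd x y) z)))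
| ring_addC : ring_no_zero_div (all3 (Feq (tadd x y) (tadd y x)))
| ring_add0 : ring_no_zero_div (all3 (Feq (tadd (tzero 3) x) x))
| ring_addN : ring_no_zero_div
    (Fall (Fex (Feq (tadd (@tvar 2 0 isT) (@tvar 2 1 isT)) (tzero 2))))
| ring_mulA : ring_no_zero_div
    (all3 (Feq (tmul x (tmul y z)) (tmul (tmul x y) z)))
| ring_mul1l : ring_no_zero_div (all3 (Feq (tmul (tone 3) x) x))
| ring_mul1r : ring_no_zero_div (all3 (Feq (tmul x (tone 3)) x))
| ring_mulDl : ring_no_zero_div
    (all3 (Feq (tmul (tadd x y) z) (tadd (tmul x z) (tmul y z))))
| ring_mulDr : ring_no_zero_div
    (all3 (Feq (tmul x (tadd y z)) (tadd (tmul x y) (tmul x z))))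
| ring_mul_eq0 : ring_no_zero_div
    (all3 (Fimp (Feq (tmul x y) (tzero 3))
                (For (Feq x (tzero 3)) (Feq y (tzero 3))))).

End RingTheory.

Definition subfield (R : structure ring_language) (S : set R) : Prop :=
  let zero : R := @finterp _ R Rzero (@tnil R) in
  let one : R := @finterp _ R Rone (@tnil R) in
  let add (a b : R) : R := @finterp _ R Radd (tpair a b) in
  let mul (a b : R) : R := @finterp _ R Rmul (tpair a b) in
  [/\ S zero /\ S one,
      zero <> one,
      (forall a b, S a -> S b -> S (add a b) /\ S (mul a b)),
      (forall a, S a -> exists2 b, S b & add a b = zero) &
      (forall a b, S a -> S b -> mul a b = mul b a) /\
      (forall a, S a -> a <> zero -> exists2 b, S b & mul a b = one)].

(** * Monster models *)

(* Cardinal numbers are represented by types. *)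
Definition smaller (X : Type) (A : set X) (K : Type) : Prop :=
  A #<= [set: K] /\ ~ ([set: K] #<= A).

(* By the usual convention, |T| is max(|L|, aleph_0), the number of
   L-formulas. *)
Definition theory_smaller (L : language) (K : Type) : Prop :=
  smaller [set: (funsym L + relsym L + nat)%type] K.

Record pformula (L : language) (M : structure L) (n : nat) : Type := PFormula {
  pf_npar : nat;
  pf_form : formula L (n + pf_npar);
  pf_par : 'I_pf_npar -> M
}.
Arguments pf_par {L M n} p _.

Definition pf_over L (M : structure L) n (A : set M) (p : pformula M n) : Prop :=
  forall i, A (pf_par p i).

Definition pf_set L (M : structure L) n (p : pformula M n) : set ('I_n -> M) :=
  [set v | sat (pf_form p) (tcat v (pf_par p))].

Definition definable_over L (M : structure L) n (A : set M)
    (V : set ('I_n -> M)) : Prop :=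
  exists2 p : pformula M n, pf_over A p & V = pf_set p.

Definition same_type L (M : structure L) n (A : set M) (v w : 'I_n -> M) : Prop :=
  forall p : pformula M n, pf_over A p -> (pf_set p v <-> pf_set p w).

Definition saturated (K : Type) L (M : structure L) : Prop :=
  forall (A : set M) (P : set (pformula M 1)),
    smaller A K ->
    (forall p, P p -> pf_over A p) ->
    (forall Q, Q `<=` P -> finite_set Q ->
       exists v, forall p, Q p -> pf_set p v) ->
    exists v, forall p, P p -> pf_set p v.

Definition automorphism L (M : structure L) (s : M -> M) : Prop :=
  [/\ bijective s,
      (forall f (a : 'I_(@farity L f) -> M),
         s (finterp a) = finterp (fun i => s (a i))) &
      (forall r (a : 'I_(@rarity L r) -> M),
         rinterp a <-> rinterp (fun i => s (a i)))].

Definition elementary_on L (M : structure L) (A : set M) (f : M -> M) : Prop :=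
  forall n (phi : formula L n) (a : 'I_n -> M),
    (forall i, A (a i)) -> (sat phi a <-> sat phi (fun i => f (a i))).

Definition strongly_homogeneous (K : Type) L (M : structure L) : Prop :=
  forall (A : set M) (f : M -> M),
    smaller A K -> elementary_on A f ->
    exists2 s, automorphism s & forall a, A a -> s a = f a.

Definition monster (K : Type) L (T : theory L) (M : structure L) : Prop :=
  [/\ models M T, saturated K M & strongly_homogeneous K M].

(** * Existential matroids *)

Record matroid (M : Type) (cl : set M -> set M) : Prop := Matroid {
  matroid_ext : forall X, X `<=` cl X;
  matroid_mono : forall X Y, X `<=` Y -> cl X `<=` cl Y;
  matroid_idem : forall X, cl (cl X) = cl X;
  matroid_fin :
    forall X, cl X = \bigcup_(A in [set A | A `<=` X /\ finite_set A]) cl A;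
  matroid_exchange : forall X a c,
    cl (X `|` [set c]) a -> ~ cl X a -> cl (X `|` [set a]) c
}.

(* The variable x is the one of index 0, followed by the tuple y. *)
Definition narrow L (M : structure L) (cl : set M -> set M) m
    (phi : formula L (1 + m)) : Prop :=
  forall (a : M) (b : 'I_m -> M),
    sat phi (tcat (fun _ : 'I_1 => a) b) -> cl (range b) a.

Definition definable_matroid L (M : structure L) (cl : set M -> set M) : Prop :=
  forall A : set M,
    cl A = [set x | exists m (phi : formula L (1 + m)) (a : 'I_m -> M),
              [/\ narrow cl phi, (forall i, A (a i)) &
                  sat phi (tcat (fun _ : 'I_1 => x) a)]].

Definition existence (K : Type) L (M : structure L) (cl : set M -> set M) : Prop :=
  forall (a : M) (B C : set M),
    smaller B K -> smaller C K -> ~ cl B a ->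
    exists2 a' : M,
      same_type B (fun _ : 'I_1 => a) (fun _ : 'I_1 => a') &
      ~ cl (B `|` C) a'.

Record existential_matroid (K : Type) L (M : structure L)
    (cl : set M -> set M) : Prop := ExistentialMatroid {
  em_matroid : matroid cl;
  em_definable : definable_matroid cl;
  em_existence : existence K cl;
  em_nontrivial : cl <> (fun _ : set M => [set: M])
}.

(** * Rank and dimension *)

(* The subtuple of [b] with index set [I] is [cl]-independent over [A]. *)
Definition independent M (cl : set M -> set M) (A : set M) n (b : 'I_n -> M)
    (I : {set 'I_n}) : Prop :=
  forall i, i \in I ->
    ~ cl (A `|` [set x | exists j, [/\ j \in I, j != i & b j = x]]) (b i).

(* All the maximal independent subtuples have the same cardinality. *)
Definition rk M (cl : set M -> set M) n (b : 'I_n -> M) (A : set M) : nat :=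
  \max_(I : {set 'I_n} | maxset (fun J => `[< independent cl A b J >]) I) #|I|.

(* The dimension of a set [V] definable over [A]; [None] stands for -oo.
   As [rk cl b A <= n], the maximum may be taken over the k <= n. *)
Definition dim M (cl : set M -> set M) n (A : set M) (V : set ('I_n -> M)) :
    option nat :=
  if `[< V !=set0 >] then
    Some (\max_(k < n.+1 | `[< exists2 b, V b & rk cl b A = k >]) k)
  else None.

Definition as_set1 M (S : set M) : set ('I_1 -> M) := [set v | S (v ord0)].

(* Main.v *)
(* If a is fixed by the automorphisms fixing a finite set B, then a lies in
   cl(B): otherwise Existence gives a' of the same type over B outside
   cl(B, a), and homogeneity an automorphism over B moving a to a'.
   Let D be definable over a finite B and not contained in cl(B). For every z,
   the map (u, v) |-> u + z v is not injective on D x D, by a rank computation;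
   hence z (v - v') = u' - u for some u, v, u', v' in D with v <> v', and z is
   fixed by the automorphisms fixing these four elements.
   For D a subfield S of dimension 1 this gives z in S. For D = phi(M, b) with
   phi narrow for cl and D not contained in cl'(b), it gives M = cl(b),
   contradicting nontriviality; so cl is contained in cl', and conversely by
   symmetry. *)
Require Import Defs.
From HB Require Import structures.
From mathcomp Require Import all_boot.
From mathcomp Require Import boolp classical_sets functions cardinality.
From mathcomp Require Import ssralg.

Set Implicit Arguments.
Unset Strict Implicit.
Unset Printing Implicit Defensive.

Local Open Scope classical_set_scope.
Local Open Scope card_scope.

(** * Tuple operations and their compatibility with maps *)

Section Tuples.
Variables (X Y : Type) (f : X -> Y).

Lemma tsnoc_max n (v : 'I_n -> X) x : tsnoc v x ord_max = x.
Proof. by rewrite /tsnoc unlift_none. Qed.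

Lemma tsnoc_lift n (v : 'I_n -> X) x i : tsnoc v x (lift ord_max i) = v i.
Proof. by rewrite /tsnoc liftK. Qed.

Lemma tsnoc_last n (v : 'I_n -> X) x (h : n < n.+1) : tsnoc v x (Ordinal h) = x.
Proof. by rewrite -[RHS](tsnoc_max v); congr tsnoc; apply/val_inj. Qed.

Lemma tsnoc_widen n (v : 'I_n -> X) x k (h : k < n) (h' : k < n.+1) :
  tsnoc v x (Ordinal h') = v (Ordinal h).
Proof.
rewrite -[RHS](tsnoc_lift v x); congr tsnoc; apply/val_inj => /=.
by rewrite /bump leqNgt h.
Qed.

Lemma comp_tsnoc n (v : 'I_n -> X) x :
  (fun i => f (tsnoc v x i)) = tsnoc (fun i => f (v i)) (f x).
Proof. by apply/funext => i; rewrite /tsnoc; case: unlift. Qed.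

Lemma comp_tcat n m (v : 'I_n -> X) (w : 'I_m -> X) :
  (fun i => f (tcat v w i)) = tcat (fun i => f (v i)) (fun i => f (w i)).
Proof. by apply/funext => i; rewrite /tcat; case: fintype.split. Qed.

Lemma comp_tpair x y : (fun i => f (tpair x y i)) = tpair (f x) (f y).
Proof. by apply/funext => i; rewrite /tpair; case: eqP. Qed.

Lemma comp_tnil : (fun i => f (tnil X i)) = tnil Y.
Proof. by apply/funext => -[]. Qed.

End Tuples.

(** * Automorphisms, substitution of variables, and types *)

Section Automorphisms.
Variables (L : language) (M : structure L).

Lemma eval_automorphism (s : M -> M) n (v : 'I_n -> M) (t : term L n) :
  automorphism s -> s (eval v t) = eval (fun i => s (v i)) t.
Proof.
move=> [_ sf _]; elim: t => //= f ts IH.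
by rewrite sf; congr finterp; apply/funext.
Qed.

(** Injectivity of [s] settles equalities; surjectivity settles the quantifiers, every [x] being
    [s (g x)]. *)
Lemma sat_automorphism (s : M -> M) n (phi : formula L n) (v : 'I_n -> M) :
  automorphism s -> sat phi v <-> sat phi (fun i => s (v i)).
Proof.
move=> sA; have [sbij _ sr] := sA.
have evalE k (w : 'I_k -> M) (t : term L k) := eval_automorphism w t sA.
elim: phi v => //= {n}.
- move=> n t u v; rewrite -!evalE.
  by split=> [->//|/(bij_inj sbij)].
- move=> n r ts v; rewrite sr.
  by under eq_fun do rewrite evalE.
- by move=> n p IHp q IHq v; rewrite (IHp v) (IHq v).
- by move=> n p IHp q IHq v; rewrite (IHp v) (IHq v).
- by move=> n p IHp q IHq v; rewrite (IHp v) (IHq v).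
- case: sbij => g gK Kg n p IHp v; split=> [H x|H x].
  + by rewrite -(Kg x) -comp_tsnoc -IHp.
  + by rewrite IHp comp_tsnoc.
- case: sbij => g gK Kg n p IHp v; split=> -[x px].
  + by exists (s x); rewrite -comp_tsnoc -IHp.
  + by exists (g x); rewrite IHp comp_tsnoc Kg.
Qed.

Lemma rename_term n m (f : 'I_n -> 'I_m) (t : term L n) :
  exists u : term L m, forall v : 'I_m -> M, eval v u = eval (v \o f) t.
Proof.
elim: t => [i|g ts /choice[us usE]]; first by exists (Var L (f i)).
by exists (App us) => v /=; congr finterp; apply/funext.
Qed.

(** This serves to regroup the variables of an arbitrary formula into one free variable followed by
    parameters, the shape that [same_type] speaks about. *)
Lemma rename_formula n m (f : 'I_n -> 'I_m) (phi : formula L n) :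
  exists psi : formula L m, forall v : 'I_m -> M, sat psi v <-> sat phi (v \o f).
Proof.
(* Under a quantifier the renaming is extended so that the bound, last variable goes to the last
   variable. *)
have ext k l (g : 'I_k -> 'I_l) : exists g' : 'I_k.+1 -> 'I_l.+1,
    forall (v : 'I_l -> M) x, tsnoc v x \o g' = tsnoc (v \o g) x.
  exists (fun i => if unlift ord_max i is Some j then lift ord_max (g j)
                   else ord_max).
  move=> v x; apply/funext => i /=; rewrite /tsnoc.
  by case: (unlift ord_max i) => [j|]; rewrite ?liftK ?unlift_none.
elim: phi m f => {n}.
- move=> n t u m f; have [t' tE] := rename_term f t.
  have [u' uE] := rename_term f u.
  by exists (Feq t' u') => v /=; rewrite tE uE.
- move=> n r ts m f.
  have /choice[us usE] := fun i => rename_term f (ts i).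
  by exists (Frel us) => v /=; under eq_fun do rewrite usE.
- by move=> n m f; exists (Fbot L m).
- move=> n p IHp q IHq m f; have [p' pE] := IHp m f; have [q' qE] := IHq m f.
  by exists (Fand p' q') => v /=; rewrite pE qE.
- move=> n p IHp q IHq m f; have [p' pE] := IHp m f; have [q' qE] := IHq m f.
  by exists (For p' q') => v /=; rewrite pE qE.
- move=> n p IHp q IHq m f; have [p' pE] := IHp m f; have [q' qE] := IHq m f.
  by exists (Fimp p' q') => v /=; rewrite pE qE.
- move=> n p IHp m f; have [f' f'E] := ext _ _ f; have [p' pE] := IHp _ f'.
  by exists (Fall p') => v /=; split=> H x; have := H x; rewrite pE f'E.
- move=> n p IHp m f; have [f' f'E] := ext _ _ f; have [p' pE] := IHp _ f'.
  by exists (Fex p') => v /=; split=> -[x H]; exists x; move: H; rewrite pE f'E.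
Qed.

(* The nonempty [B] supplies a dummy value for the parameters of the renamed
   formula that stand for the variables sent to [a]. *)
Lemma same_type_elementary (B : set M) (a a' : M) :
  B !=set0 -> ~ B a ->
  same_type B (fun _ : 'I_1 => a) (fun _ : 'I_1 => a') ->
  elementary_on (B `|` [set a]) (fun x => if `[< x = a >] then a' else x).
Proof.
move=> [b0 Bb0] nBa st n phi c cBa.
(* All positions holding [a] merge into the free variable; every other position becomes its own
   parameter. *)
pose f (i : 'I_n) : 'I_(1 + n) :=
  if `[< c i = a >] then lshift n ord0 else rshift 1 i.
have [psi psiE] := rename_formula f phi.
pose p := @PFormula L M 1 n psi (fun i => if `[< c i = a >] then b0 else c i).
have pB : pf_over B p.
  by move=> i; rewrite /p /=; case: asboolP => // ?; case: (cBa i).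
have pE x : pf_set p (fun _ : 'I_1 => x) <->
            sat phi (fun i => if `[< c i = a >] then x else c i).
  rewrite /pf_set /= psiE; set v := _ \o f.
  suff -> : v = (fun i => if `[< c i = a >] then x else c i) by [].
  apply/funext => i; rewrite /v /= /f; case: asboolP => ca.
  - by rewrite /tcat (unsplitK (inl _)).
  - by rewrite /tcat (unsplitK (inr _)) /=; case: asboolP.
have := st p pB; rewrite !pE.
suff -> : (fun i => if `[< c i = a >] then a else c i) = c by [].
by apply/funext => i; case: asboolP.
Qed.

Lemma definable_over_automorphism (B D : set M) (s : M -> M) :
  definable_over B (as_set1 D) -> automorphism s -> (forall b, B b -> s b = b) ->
  forall x, D x -> D (s x).
Proof.
move=> [p pB DE] sA sB x Dx.
have : as_set1 D (fun=> x) by [].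
rewrite DE /pf_set /= (sat_automorphism _ _ sA) comp_tcat => H.
suff: as_set1 D (fun=> s x) by [].
rewrite DE /pf_set /=.
suff <- : (fun i => s (pf_par p i)) = pf_par p by [].
by apply/funext => i; apply/sB/pB.
Qed.

Lemma definable_over_same_type (B D : set M) (a a' : M) :
  definable_over B (as_set1 D) ->
  same_type B (fun _ : 'I_1 => a) (fun _ : 'I_1 => a') -> D a -> D a'.
Proof.
move=> [p pB DE] st Da; suff: as_set1 D (fun=> a') by [].
by rewrite DE -(st p pB) -DE.
Qed.

End Automorphisms.

(** The summand [nat] in [theory_smaller] embeds the natural numbers into [K], so [K] is
    infinite. *)
Lemma finite_smaller (L : language) (K : Type) (X : Type) (A : set X) :
  theory_smaller L K -> finite_set A -> smaller A K.
Proof.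
move=> [LK _] finA.
have natK : [set: nat] #<= [set: K].
  apply: card_le_trans LK.
  have inrE : range (@inr (funsym L + relsym L) nat) #= [set: nat].
    by apply: inj_card_eq => ? ? _ _ [].
  by rewrite -(card_le_eql inrE); apply: subset_card_le.
split.
  by apply: card_le_trans natK; apply: finite_set_countable.
by move=> /(card_le_trans natK)/card_le_finite/(_ finA)/infinite_nat.
Qed.

(** * Models of the ring axioms as rings without zero divisors *)

Section DomainModel.
Variables (R : structure ring_language) (hR : models R ring_no_zero_div).

(* The proof argument is what lets the ring structure be a canonical instance. *)
Definition model_ring of models R ring_no_zero_div : Type := carrier R.
Local Notation D := (model_ring hR).

Let zero : R := @finterp _ R Rzero (@tnil R).
Let one : R := @finterp _ R Rone (@tnil R).
Let add (a b : R) : R := @finterp _ R Radd (tpair a b).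
Let mul (a b : R) : R := @finterp _ R Rmul (tpair a b).

Local Lemma eval_tadd n (v : 'I_n -> R) s t :
  eval v (tadd s t) = add (eval v s) (eval v t).
Proof. by rewrite /= comp_tpair. Qed.

Local Lemma eval_tmul n (v : 'I_n -> R) s t :
  eval v (tmul s t) = mul (eval v s) (eval v t).
Proof. by rewrite /= comp_tpair. Qed.

Local Lemma eval_tzero n (v : 'I_n -> R) : eval v (tzero n) = zero.
Proof. by rewrite /= comp_tnil. Qed.

Local Lemma eval_tone n (v : 'I_n -> R) : eval v (tone n) = one.
Proof. by rewrite /= comp_tnil. Qed.

Local Lemma eval_tvar_last n (v : 'I_n -> R) x (h : n < n.+1) :
  eval (tsnoc v x) (tvar h) = x.
Proof. exact: tsnoc_last. Qed.

Local Lemma eval_tvar_widen n (v : 'I_n -> R) x k (h : k < n) (h' : k < n.+1) :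
  eval (tsnoc v x) (tvar h') = eval v (tvar h).
Proof. exact: tsnoc_widen. Qed.

Let evalE := (eval_tadd, eval_tmul, eval_tzero, eval_tone).
(** The last variable is read off directly; variables 0 and 1 are pushed below [tsnoc], at fixed
    indices so that [isT] proves the bounds. *)
Let varE := (eval_tvar_last, fun n v x => @eval_tvar_widen n.+1 v x 0 isT,
             fun n v x => @eval_tvar_widen n.+2 v x 1 isT).

Local Lemma model_addA : associative (add : D -> D -> D).
Proof.
by move=> x y z; have := hR ring_addA x y z; cbn [sat]; rewrite !evalE !varE.
Qed.

Local Lemma model_addC : commutative (add : D -> D -> D).
Proof.
(* The last [x] fills the third quantifier of [all3]. *)
by move=> x y; have := hR ring_addC x y x; cbn [sat]; rewrite !evalE !varE.
Qed.

Local Lemma model_add0 : left_id (zero : D) (add : D -> D -> D).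
Proof.
by move=> x; have := hR ring_add0 x x x; cbn [sat]; rewrite !evalE !varE.
Qed.

Local Lemma model_addN : {opp : D -> D | left_inverse (zero : D) opp add}.
Proof.
apply: cid; have /choice[opp oppP] : forall x : R, exists y, add y x = zero.
  move=> x; have [y xy0] := hR ring_addN x; exists y; move: xy0; cbn [sat].
  by rewrite model_addC !evalE !varE.
by exists opp.
Qed.

Local Lemma model_mulA : associative (mul : D -> D -> D).
Proof.
by move=> x y z; have := hR ring_mulA x y z; cbn [sat]; rewrite !evalE !varE.
Qed.

Local Lemma model_mul1l : left_id (one : D) (mul : D -> D -> D).
Proof.
by move=> x; have := hR ring_mul1l x x x; cbn [sat]; rewrite !evalE !varE.
Qed.

Local Lemma model_mul1r : right_id (one : D) (mul : D -> D -> D).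
Proof.
by move=> x; have := hR ring_mul1r x x x; cbn [sat]; rewrite !evalE !varE.
Qed.

Local Lemma model_mulDl : left_distributive (mul : D -> D -> D) add.
Proof.
by move=> x y z; have := hR ring_mulDl x y z; cbn [sat]; rewrite !evalE !varE.
Qed.

Local Lemma model_mulDr : right_distributive (mul : D -> D -> D) add.
Proof.
by move=> x y z; have := hR ring_mulDr x y z; cbn [sat]; rewrite !evalE !varE.
Qed.

HB.instance Definition _ := gen_eqMixin D.
HB.instance Definition _ := gen_choiceMixin D.
(** A [PzRing] may be the zero ring, since the axioms do not assert [0 <> 1]. *)
HB.instance Definition _ := GRing.isPzRing.Build D model_addA model_addC
  model_add0 (projT2 model_addN) model_mulA model_mul1l model_mul1r
  model_mulDl model_mulDr.

Local Open Scope ring_scope.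

Lemma model_ring_mulf_eq0 (x y : D) : x * y = 0 -> x = 0 \/ y = 0.
Proof.
by have := hR ring_mul_eq0 x y x; cbn [sat]; rewrite !evalE !varE.
Qed.

Lemma model_ring_mulIf (z x y : D) : z <> 0 -> x * z = y * z -> x = y.
Proof.
move=> z0 /eqP; rewrite -GRing.subr_eq0 -GRing.mulrBl => /eqP.
by case/model_ring_mulf_eq0 => // /GRing.subr0_eq.
Qed.

(** Multiplying [z * d] on the right by the inverse of [d] in [S] recovers [z]; the ambient ring may
    be noncommutative. *)
Lemma model_ring_subfield_div (S : set D) (d z : D) :
  @subfield R S -> S d -> d <> 0 -> S (z * d) -> S z.
Proof.
move=> [_ _ SDM _ [_ Sinv]] Sd d0 Szd.
have [t St dt1] := Sinv d Sd d0.
have <- : z * d * t = z by rewrite -GRing.mulrA [d * t]dt1 GRing.mulr1.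
by have [_] := SDM _ _ Szd St.
Qed.

Lemma model_ring_subfieldB (S : set D) (x y : D) :
  @subfield R S -> S x -> S y -> S (x - y).
Proof.
move=> [_ _ SDM Sopp _] Sx Sy; have [y' Sy' yy'0] := Sopp y Sy.
(* By uniqueness of additive inverses, the negative found in [S] is that of the ring. *)
have <- : y' = - y :> D by apply: (@GRing.addrI _ y); rewrite GRing.subrr.
by have [] := SDM _ _ Sx Sy'.
Qed.
End DomainModel.

(** * Closure, automorphisms and rank in one existential matroid *)

Section ExistentialMatroid.
Variables (L : language) (T : theory L) (K : Type) (hK : theory_smaller L K).
Variables (M : structure L) (hM : monster K T M).
Variables (cl : set M -> set M) (hcl : existential_matroid K cl).

Let finsm (A : set M) : finite_set A -> smaller A K := finite_smaller hK.
Let clM := em_matroid hcl.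
Let clS X Y := @matroid_mono _ _ clM X Y.

Lemma cl_closed X Y : X `<=` cl Y -> cl X `<=` cl Y.
Proof. by move=> /clS; rewrite (matroid_idem clM). Qed.

(** [B] is nonempty to provide the dummy parameter of [same_type_elementary]. The contradiction is
    that a fixed [a] equals [a'], which avoids [cl (B, a)]. *)
Lemma fixed_in_cl (B : set M) (a : M) : finite_set B -> B !=set0 ->
  (forall s, automorphism s -> (forall b, B b -> s b = b) -> s a = a) -> cl B a.
Proof.
move=> finB B0 fixa; apply: contrapT => nclBa.
have nBa : ~ B a by move=> /(matroid_ext clM).
have [a' st ncla'] :=
  em_existence hcl (finsm finB) (finsm (finite_set1 a)) nclBa.
have [_ _ homog] := hM.
have finBa : finite_set (B `|` [set a]) by rewrite finite_setU.
have [s sA sE] := homog _ _ (finsm finBa) (same_type_elementary B0 nBa st).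
have sB b : B b -> s b = b.
  move=> Bb; rewrite sE; last by left.
  by case: asboolP => // ba; rewrite -ba in nBa.
apply: ncla'; have := fixa s sA sB; rewrite sE; last by right.
rewrite asboolT // => ->.
by apply: (matroid_ext clM); right.
Qed.

(** Nontriviality and monotonicity give a point outside [cl set0]; Existence over the empty set then
    moves it off [cl B]. *)
Lemma exists_notin_cl (B : set M) : finite_set B -> exists a, ~ cl B a.
Proof.
move=> finB; have [a ncla] : exists a, ~ cl set0 a.
  apply: contrapT => clT; apply: (em_nontrivial hcl); apply/funext => X.
  apply/seteqP; split=> // x _; apply: clS (sub0set X) _ _.
  by apply: contrapT => nclx; apply: clT; exists x.
have [a' _] := em_existence hcl (finsm (finite_set0 M)) (finsm finB) ncla.
by rewrite set0U; exists a'.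
Qed.

(* Take [u], [v] in [D] independent over [B] and [z]. If [g] were injective on
   [D * D], then both would be in the closure of [B], [z] and [g u v], which
   has rank at most 1 over [B] and [z]. *)
Lemma not_injective_on_square (B D : set M) (z a : M) (g : M -> M -> M) :
  finite_set B -> definable_over B (as_set1 D) -> D a -> ~ cl B a ->
  (forall s u v, automorphism s -> s z = z -> s (g u v) = g (s u) (s v)) ->
  exists u v u' v', [/\ D u, D v, D u' & D v'] /\
    g u v = g u' v' /\ ~ (u = u' /\ v = v').
Proof.
move=> finB defD Da nclBa gE; apply: contrapT => inj.
have [u stu nclu] := em_existence hcl (finsm finB) (finsm (finite_set1 z)) nclBa.
have finzu : finite_set [set z; u] by rewrite finite_setU.
have [v stv nclv] := em_existence hcl (finsm finB) (finsm finzu) nclBa.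
have Du := definable_over_same_type defD stu Da.
have Dv := definable_over_same_type defD stv Da.
pose w := g u v; pose C := B `|` [set z] `|` [set w].
have finC : finite_set C by rewrite /C !finite_setU.
have C0 : C !=set0 by exists w; right.
have clC : cl C u /\ cl C v.
  (* Such an [s] preserves [D] and fixes [z] and [w], so [(s u, s v)] has the same image as
     [(u, v)]; injectivity makes the pairs equal. *)
  have fixuv s : automorphism s -> (forall b, C b -> s b = b) ->
      s u = u /\ s v = v.
    move=> sA sC; apply: contrapT => nfix; apply: inj.
    have sB b : B b -> s b = b by move=> Bb; apply: sC; left; left.
    exists (s u), (s v), u, v; split.
      by split=> //; apply: definable_over_automorphism defD sA sB _ _.
    split=> //; rewrite -gE //; last by apply: sC; left; right.
    by apply: sC; right.
  by split; apply: fixed_in_cl => // s sA sC; have [] := fixuv s sA sC.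
(* Exchanging [u] and [w] over [B], [z] puts [w], hence all of [C] and with it [v], in
   [cl (B, z, u)], against the choice of [v]. *)
have clw := matroid_exchange clM clC.1 nclu.
apply: nclv; apply: cl_closed clC.2 => x [Bzx|->]; last first.
  by rewrite setUA.
by apply: (matroid_ext clM); case: Bzx; [left|right; left].
Qed.

End ExistentialMatroid.

(** * Quotients of differences, uniqueness of the matroid, and subfields *)

Lemma reduct_automorphism L0 L (e : expansion L0 L) (M : structure L) s :
  @automorphism L M s -> @automorphism L0 (reduct e M) s.
Proof.
by move=> [sbij sf sr]; split=> // [f a|r a]; [apply: sf|apply: sr].
Qed.

Section RingExpansion.
Variables (L : language) (T : theory L) (K : Type) (hK : theory_smaller L K).
Variables (M : structure L) (hM : monster K T M).
Variables (e : expansion ring_language L).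
Variable (hR : models (reduct e M) ring_no_zero_div).
Notation R := (model_ring hR).

Local Open Scope ring_scope.

Lemma automorphismD (s : M -> M) (x y : R) :
  automorphism s -> (s (x + y) : R) = (s x : R) + (s y : R).
Proof.
move=> /(reduct_automorphism e)[_ sf _].
by rewrite (sf Radd) comp_tpair.
Qed.

(** Subtraction is not a symbol of the language, so its preservation is deduced from that of
    addition by cancellation. *)
Lemma automorphismB (s : M -> M) (x y : R) :
  automorphism s -> (s (x - y) : R) = (s x : R) - (s y : R).
Proof.
move=> sA; apply: (@GRing.addIr R (s y)).
by rewrite -automorphismD // !GRing.subrK.
Qed.

Lemma automorphismM (s : M -> M) (x y : R) :
  automorphism s -> (s (x * y) : R) = (s x : R) * (s y : R).
Proof.
move=> /(reduct_automorphism e)[_ sf _].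
by rewrite (sf Rmul) comp_tpair.
Qed.

Lemma quotient_of_differences (cl : set M -> set M) (B D : set M) (a : M)
    (z : R) :
  existential_matroid K cl ->
  finite_set B -> definable_over B (as_set1 D) -> D a -> ~ cl B a ->
  exists u v u' v' : R, [/\ D u, D v, D u' & D v'] /\
    (v - v' <> 0 /\ z * (v - v') = u' - u).
Proof.
move=> hcl finB defD Da nclBa.
have gE (s : M -> M) (u v : R) : automorphism s -> s z = z ->
    s (u + z * v) = (s u : R) + z * (s v : R).
  by move=> sA sz; rewrite automorphismD // automorphismM // sz.
have [u [v [u' [v' [Duv [eqg neq]]]]]] :=
  not_injective_on_square hK hM hcl finB defD Da nclBa gE.
exists u, v, u', v'; split=> //.
have zE : z * ((v : R) - (v' : R)) = (u' : R) - (u : R).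
  rewrite GRing.mulrBr; apply: (@GRing.addrI _ (u : R)).
  by rewrite GRing.addrA eqg GRing.addrK [RHS]GRing.addrC GRing.subrK.
(* If [v = v'], the equation [zE] forces [u = u'] as well, so the two pairs would coincide. *)
split=> // v0; apply: neq; split; last exact: (@GRing.subr0_eq R).
by apply/esym/(@GRing.subr0_eq R); rewrite -zE v0 GRing.mulr0.
Qed.

Lemma existential_matroid_le (cl cl' : set M -> set M) :
  existential_matroid K cl -> existential_matroid K cl' ->
  forall X, cl X `<=` cl' X.
Proof.
move=> hcl hcl' X a; rewrite {1}(em_definable hcl) => -[m [phi [b [nphi Xb phia]]]].
pose B := range b.
have finB : finite_set B by apply: finite_image.
have BX : B `<=` X by move=> _ [i _ <-].
apply: (matroid_mono (em_matroid hcl') BX); apply: contrapT => nclBa.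
(* [D] lies in [cl B] by narrowness but contains [a] outside [cl' B]: the collision is found using
   [cl'], and its consequence is read in [cl]. *)
pose D : set M := [set x | sat phi (tcat (fun=> x) b)].
have DB : D `<=` cl B by move=> x /nphi.
have defD : definable_over B (as_set1 D).
  exists (PFormula phi b); first by move=> i; exists i.
  apply/funext => v; rewrite /as_set1 /D /pf_set /=.
  by congr (sat phi (tcat _ b)); apply/funext => i; rewrite ord1.
have [z nclz] := exists_notin_cl hK hcl finB.
have [u [v [u' [v' [[Du Dv Du' Dv'] [d0 zE]]]]]] :=
  quotient_of_differences z hcl' finB defD phia nclBa.
apply: nclz; pose C := B `|` [set u; v; u'; v'].
have CB : C `<=` cl B.
  move=> x [/(matroid_ext (em_matroid hcl))//|].
  by move=> [[[->|->]|->]|->]; apply: DB.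
apply: (cl_closed hcl CB).
have finC : finite_set C by rewrite /C !finite_setU.
have Cu : C !=set0 by exists u; right; left; left; left.
apply: (fixed_in_cl hK hM hcl finC Cu) => s sA sC.
have su : s u = u by apply: sC; right; left; left; left.
have sv : s v = v by apply: sC; right; left; left; right.
have su' : s u' = u' by apply: sC; right; left; right.
have sv' : s v' = v' by apply: sC; right; right.
(* Both [z] and [s z] multiply [v - v'] to the fixed element [u' - u], so they agree by
   cancellation. *)
apply: (@model_ring_mulIf _ hR (v - v') _ _ d0).
rewrite zE -{1}su -{1}su' -automorphismB // -zE automorphismM //.
by rewrite (@automorphismB s) // sv sv'.
Qed.

Lemma dim1_subfield_full (cl : set M -> set M) (S A : set M) :
  existential_matroid K cl -> definable_over A (as_set1 S) ->
  @subfield (reduct e M) S -> dim cl A (as_set1 S) = Some 1%N -> S = [set: M].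
Proof.
move=> hcl [p pA SE] Sfield dimS.
have [a Sa nclAa] : exists2 a, S a & ~ cl A a.
  (* If [S] were inside [cl A], only the empty subtuple would be independent over [A], and the
     dimension would be 0. *)
  apply: contrapT => ScA; move: dimS; rewrite /dim; case: asboolP => // _ [].
  suff -> : (\max_(k < 2 | `[< exists2 b, as_set1 S b & rk cl b A = k >]) k)%N = 0%N by [].
  apply/eqP; rewrite -leqn0; apply/bigmax_leqP => k /asboolP[b Sb <-].
  rewrite /rk; apply/bigmax_leqP => I /maxsetP[/asboolP indep _].
  rewrite leqn0 cards_eq0; apply/set0Pn => -[i iI].
  apply: ScA; exists (b ord0) => // clAb; apply: (indep i iI).
  apply: (matroid_mono (em_matroid hcl)) (@subsetUl _ _ _) _ _.
  by rewrite ord1.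
(* [A] may be infinite, so it is replaced by the finitely many parameters of a formula defining
   [S]. *)
pose B := range (pf_par p).
have finB : finite_set B by apply: finite_image.
have defS : definable_over B (as_set1 S) by exists p => // i; exists i.
have nclBa : ~ cl B a.
  by apply: contra_not nclAa; apply: (matroid_mono (em_matroid hcl)) => _ [i _ <-].
apply/seteqP; split=> // z _.
have [u [v [u' [v' [[Su Sv Su' Sv'] [d0 zE]]]]]] :=
  quotient_of_differences z hcl finB defS Sa nclBa.
apply: (@model_ring_subfield_div _ hR S _ z Sfield _ d0).
  exact: model_ring_subfieldB.
by rewrite zE; apply: model_ring_subfieldB.
Qed.

End RingExpansion.

Theorem theorem3p47
    (L : language) (T : theory L)
    (hcomplete : complete_theory T) (hinf : only_infinite_models T)
    (K : Type) (hK : theory_smaller L K)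
    (M : structure L) (hM : monster K T M)
    (cl : set M -> set M) (hcl : existential_matroid K cl)
    (e : expansion ring_language L) (hring : expands e T ring_no_zero_div) :
  (forall cl' : set M -> set M, existential_matroid K cl' -> cl' = cl) /\
  (forall (S A : set M),
     smaller A K -> definable_over A (as_set1 S) ->
     @subfield (reduct e M) S ->
     dim cl A (as_set1 S) = Some 1 ->
     S = [set: M]%classic).
Proof.
have [MT _ _] := hM; have hR := hring M MT; split.
- move=> cl' hcl'; apply/funext => X; apply/seteqP; split.
  + exact: (existential_matroid_le hK hM hR hcl' hcl).
  + exact: (existential_matroid_le hK hM hR hcl hcl').
- move=> S A _; exact: (dim1_subfield_full hK hM hR hcl).
Qed.
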